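(* Let $M,N,R$ be $\mathrm{CAU}^-_\sigma$ terms with $M\to^*_{\mathrm{CAU}^-_\sigma}N$ and $M\to^*_{\mathrm{CAU}^-_\sigma}R$, and suppose $\sigma\tau(N)$ and $\sigma\tau(R)$ are joinable in $\mathrm{CAU}^-$ (i.e. there is $S$ with $\sigma\tau(N)\to^*_{\mathrm{CAU}^-}S$ and $\sigma\tau(R)\to^*_{\mathrm{CAU}^-}S$). Then $N$ and $R$ are joinable in $\mathrm{CAU}^-_\sigma$ (there is $S'$ with $N\to^*_{\mathrm{CAU}^-_\sigma}S'$ and $R\to^*_{\mathrm{CAU}^-_\sigma}S'$).
   Context: The calculus $\mathrm{CAU}^-_\sigma$ uses nameless (de Bruijn) syntax: Terms $M,N ::= 1 \mid \lambda.M \mid M\,N \mid \mathsf{let}(M,N) \mid !_q M \mid q \triangleright M \mid \iota(\vartheta) \mid M[s] \mid \mathrm{er}(M)$; Trails $q ::= \mathsf{r} \mid \mathsf{t}(q,q') \mid \mathsf{ba} \mid \mathsf{bb} \mid \mathsf{ti} \mid \mathsf{lam}(q) \mid \mathsf{app}(q,q') \mid \mathsf{let}(q,q') \mid \mathsf{tr}(\zeta) \mid \mathrm{tl}(M)$; Substitutions $s,t ::= \langle\rangle \mid {\uparrow} \mid M\cdot s \mid s\circ t$. Index $1$; $\lambda$ binds index 1 of its body; $\mathsf{let}(M,N)$ binds index 1 in $N$; $\vartheta=\{M_1,\dots,M_9\}$ (resp. $\zeta=\{q_1,\dots,q_9\}$) is a family of nine terms (resp. trails) indexed by the trail constructors in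 the order $\mathsf{r},\mathsf{t},\mathsf{ba},\mathsf{bb},\mathsf{ti},\mathsf{lam},\mathsf{app},\mathsf{let},\mathsf{tr}$. $\mathrm{er}$ is explicit trail erasure, $\mathrm{tl}$ explicit trail extraction, $M[s]$ explicit substitution. ${\uparrow}^n={\uparrow}\circ\cdots\circ{\uparrow}$ ($n$ times); $1[{\uparrow}^n]$ is index $n+1$; $M[N]$ abbreviates $M[N\cdot\langle\rangle]$. $\sigma$-rules: $1[\langle\rangle]\to 1$; $1[M\cdot s]\to M$; $(\lambda.M)[s]\to \lambda.(M[1\cdot(s\circ{\uparrow})])$; $(M\,N)[s]\to M[s]\,N[s]$; $(!_qM)[s]\to !_q(M[s])$; $\mathsf{let}(M,N)[s]\to\mathsf{let}(M[s],N[1\cdot(s\circ{\uparrow})])$; $(q\triangleright M)[s]\to q\triangleright(M[s])$; $\iota(\{M_i\})[s]\to\iota(\{M_i[s]\})$; $M[s][t]\to M[s\circ t]$; $\langle\rangle\circ s\to s$; ${\uparrow}\circ\langle\rangle\to{\uparrow}$; ${\uparrow}\circ(M\cdot s)\to s$; $(M\cdot s)\circ t\to M[t]\cdot(s\circ t)$; $(s_1\circ s_2)\circ s_3\to s_1\circ(s_2\circ s_3)$; $\mathrm{er}(1)\to 1$; $\mathrm{er}(1[{\uparrow}^n])\to 1[{\uparrow}^n]$; $\mathrm{er}(\lambda.M)\to\lambda.\mathrm{er}(M)$; $\mathrm{er}(M\,N)\to\mathrm{er}(M)\,\mathrm{er}(N)$; $\mathrm{er}(!_qM)\to !_qM$;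 $\mathrm{er}(\mathsf{let}(M,N))\to\mathsf{let}(\mathrm{er}(M),\mathrm{er}(N))$; $\mathrm{er}(q\triangleright M)\to\mathrm{er}(M)$; $\mathrm{er}(\iota(\{M_i\}))\to\iota(\{\mathrm{er}(M_i)\})$; $\mathrm{tl}(1)\to\mathsf{r}$; $\mathrm{tl}(1[{\uparrow}^n])\to\mathsf{r}$; $\mathrm{tl}(\lambda.M)\to\mathsf{lam}(\mathrm{tl}(M))$; $\mathrm{tl}(M\,N)\to\mathsf{app}(\mathrm{tl}(M),\mathrm{tl}(N))$; $\mathrm{tl}(!_qM)\to\mathsf{r}$; $\mathrm{tl}(\mathsf{let}(M,N))\to\mathsf{let}(\mathrm{tl}(M),\mathrm{tl}(N))$; $\mathrm{tl}(q\triangleright M)\to\mathsf{t}(q,\mathrm{tl}(M))$; $\mathrm{tl}(\iota(\{M_i\}))\to\mathsf{tr}(\{\mathrm{tl}(M_i)\})$. $\tau$-rules: $\mathsf{r}\triangleright M\to M$; $q\triangleright(q'\triangleright M)\to\mathsf{t}(q,q')\triangleright M$; $!_q(q'\triangleright M)\to !_{\mathsf{t}(q,q')}M$; $\lambda.(q\triangleright M)\to\mathsf{lam}(q)\triangleright\lambda.M$; $(q\triangleright M)\,N\to\mathsf{app}(q,\mathsf{r})\triangleright M\,N$; $M\,(q\triangleright N)\to\mathsf{app}(\mathsf{r},q)\triangleright M\,N$; $\mathsf{let}(q\triangleright M,N)\to\mathsf{let}(q,\mathsf{r})\triangleright\mathsf{let}(M,N)$; $\mathsf{let}(M,q\triangleright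 N)\to\mathsf{let}(\mathsf{r},q)\triangleright\mathsf{let}(M,N)$; $\iota(\{M_1,\dots,q\triangleright M_i,\dots,M_9\})\to\mathsf{tr}(\{\mathsf{r},\dots,q,\dots,\mathsf{r}\})\triangleright\iota(\{M_1,\dots,M_9\})$; $\mathsf{t}(q,\mathsf{r})\to q$; $\mathsf{t}(\mathsf{r},q)\to q$; $\mathsf{tr}(\{\mathsf{r},\dots,\mathsf{r}\})\to\mathsf{r}$; $\mathsf{app}(\mathsf{r},\mathsf{r})\to\mathsf{r}$; $\mathsf{lam}(\mathsf{r})\to\mathsf{r}$; $\mathsf{let}(\mathsf{r},\mathsf{r})\to\mathsf{r}$; $\mathsf{t}(\mathsf{t}(q_1,q_2),q_3)\to\mathsf{t}(q_1,\mathsf{t}(q_2,q_3))$; $\mathsf{t}(\mathsf{lam}(q),\mathsf{lam}(q'))\to\mathsf{lam}(\mathsf{t}(q,q'))$; $\mathsf{t}(\mathsf{lam}(q_1),\mathsf{t}(\mathsf{lam}(q_1'),q))\to\mathsf{t}(\mathsf{lam}(\mathsf{t}(q_1,q_1')),q)$; $\mathsf{t}(\mathsf{app}(q_1,q_2),\mathsf{app}(q_1',q_2'))\to\mathsf{app}(\mathsf{t}(q_1,q_1'),\mathsf{t}(q_2,q_2'))$; $\mathsf{t}(\mathsf{app}(q_1,q_2),\mathsf{t}(\mathsf{app}(q_1',q_2'),q))\to\mathsf{t}(\mathsf{app}(\mathsf{t}(q_1,q_1'),\mathsf{t}(q_2,q_2')),q)$; the same two with $\mathsf{let}$ for $\mathsf{app}$;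 $\mathsf{t}(\mathsf{tr}(\{q_i\}),\mathsf{tr}(\{q_i'\}))\to\mathsf{tr}(\{\mathsf{t}(q_i,q_i')\})$; $\mathsf{t}(\mathsf{tr}(\{q_i\}),\mathsf{t}(\mathsf{tr}(\{q_i'\}),q))\to\mathsf{t}(\mathsf{tr}(\{\mathsf{t}(q_i,q_i')\}),q)$. $\sigma$- and $\tau$-rules apply anywhere; $\sigma\cup\tau$ is terminating and confluent and $\sigma\tau(X)$ denotes the normal form of $X$; $\equiv_{\sigma\tau}$ is the equivalence closure of $\sigma\cup\tau$. Inspection of a trail: for a trail $q$ without $\mathrm{tl}$, $q\vartheta$ is defined by $\mathsf{r}\vartheta=\vartheta(\mathsf{r})$, $\mathsf{ba}\vartheta=\vartheta(\mathsf{ba})$, $\mathsf{bb}\vartheta=\vartheta(\mathsf{bb})$, $\mathsf{ti}\vartheta=\vartheta(\mathsf{ti})$, $\mathsf{lam}(q)\vartheta=\vartheta(\mathsf{lam})\,(q\vartheta)$, $c(q,q')\vartheta=\vartheta(c)\,(q\vartheta)\,(q'\vartheta)$ for $c\in\{\mathsf{t},\mathsf{app},\mathsf{let}\}$, $\mathsf{tr}(\{q_1,\dots,q_9\})\vartheta=\vartheta(\mathsf{tr})\,(q_1\vartheta)\cdots(q_9\vartheta)$. Beta-reduction of $\mathrm{CAU}^-_\sigma$: with $F ::= \blacksquare \mid \lambda.F \mid F\,N \mid M\,F \mid \mathsf{let}(F,N) \mid \mathsf{let}(M,F) \mid q\triangleright F \mid \iota(\{\vec M,F,\vec N\}) \mid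 F[s]$: $(\lambda.M)\,N\to_{\mathrm{Beta}}\mathsf{t}(\mathsf{app}(\mathsf{lam}(\mathrm{tl}(M)),\mathrm{tl}(N)),\mathsf{ba})\triangleright\mathrm{er}(M)[\mathrm{er}(N)]$; $\mathsf{let}(!_qM,N)\to_{\mathrm{Beta}}\mathsf{t}(\mathsf{let}(\mathsf{r},\mathrm{tl}(N)),\mathsf{bb})\triangleright\mathrm{er}(N)[q\triangleright M]$; $!_qF[\iota(\vartheta)]\to_{\mathrm{Beta}}!_qF[\mathsf{ti}\triangleright q'\vartheta]$ where $q'=\sigma\tau(\mathsf{t}(q,\mathrm{tl}(F[\iota(\vartheta)])))$; closed under contexts $E_\sigma ::= \blacksquare \mid \lambda.E_\sigma \mid E_\sigma\,N \mid M\,E_\sigma \mid \mathsf{let}(E_\sigma,N) \mid \mathsf{let}(M,E_\sigma) \mid !_qE_\sigma \mid q\triangleright E_\sigma \mid \iota(\{\vec M,E_\sigma,\vec N\}) \mid E_\sigma[s] \mid M[S_\sigma]$, $S_\sigma ::= S_\sigma\circ t \mid s\circ S_\sigma \mid E_\sigma\cdot s \mid M\cdot S_\sigma$ (holes never inside $\mathrm{er}$). $\to_{\mathrm{CAU}^-_\sigma}\;=\;\to_{\mathrm{Beta}}\cup\equiv_{\sigma\tau}$. The calculus $\mathrm{CAU}^-$ (nameless): terms $M ::= 1 \mid 1[{\uparrow}^n] \mid \lambda.M \mid M\,N \mid \mathsf{let}(M,N) \mid !_qM \mid q\triangleright M \mid \iota(\vartheta)$ with trails not containing $\mathrm{tl}$.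 Contexts $E ::= \blacksquare \mid \lambda.E \mid E\,M \mid M\,E \mid \mathsf{let}(E,M) \mid \mathsf{let}(M,E) \mid !_qE \mid q\triangleright E \mid \iota(\{\vec M,E,\vec N\})$; bang-free contexts $F$ are the same without $!_qE$. Principal contractions: $(\lambda.M)\,N\to_\beta\mathsf{ba}\triangleright M\{N\}$; $\mathsf{let}(!_qM,N)\to_\beta\mathsf{bb}\triangleright N\{q\triangleright M\}$; $!_qF[\iota(\vartheta)]\to_\beta !_qF[\mathsf{ti}\triangleright q\vartheta]$; closed under $E$. $M\{N\}$ is standard capture-avoiding de Bruijn substitution of $N$ for index 1 in $M$. $M\to_{\mathrm{CAU}^-}\tau(N)$ whenever $M\to_\beta N$, with $\tau(N)$ the $\tau$-normal form. *)

(* Defs.v *)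
From Stdlib Require Import Relations.

Set Implicit Arguments.

(** Families indexed by the trail constructors. *)

Inductive branch : Set :=
  | b_r | b_t | b_ba | b_bb | b_ti | b_lam | b_app | b_let | b_tr.

(* Nine fields rather than a function [branch -> A], so that Leibniz equality
   of families is componentwise without functional extensionality. *)
Record fam (A : Type) : Type := Fam {
  f_r : A; f_t : A; f_ba : A; f_bb : A; f_ti : A;
  f_lam : A; f_app : A; f_let : A; f_tr : A }.

Definition get (A : Type) (f : fam A) (b : branch) : A :=
  match b with
  | b_r => f_r f | b_t => f_t f | b_ba => f_ba f | b_bb => f_bb f
  | b_ti => f_ti f | b_lam => f_lam f | b_app => f_app f | b_let => f_let f
  | b_tr => f_tr f
  end.

Definition tabulate (A : Type) (g : branch -> A) : fam A :=
  Fam (g b_r) (g b_t) (g b_ba) (g b_bb) (g b_ti)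
      (g b_lam) (g b_app) (g b_let) (g b_tr).

Definition branch_eq_dec (b c : branch) : {b = c} + {b <> c}.
Proof. decide equality. Defined.

(* [put f b x] is {x_1, ..., x, ..., x_9} with [x] at position [b]. *)
Definition put (A : Type) (f : fam A) (b : branch) (x : A) : fam A :=
  tabulate (fun c => if branch_eq_dec c b then x else get f c).

Definition fam_const (A : Type) (x : A) : fam A := tabulate (fun _ => x).

Definition fam_map (A B : Type) (g : A -> B) (f : fam A) : fam B :=
  tabulate (fun b => g (get f b)).

Definition fam_map2 (A B C : Type) (g : A -> B -> C)
    (f : fam A) (f' : fam B) : fam C :=
  tabulate (fun b => g (get f b) (get f' b)).

(** Syntax. *)

Inductive tm : Type :=
  | One                            (* the index 1 *)
  | Lam (M : tm)
  | App (M N : tm)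
  | Let (M N : tm)
  | Bang (q : tr) (M : tm)         (* !_q M *)
  | Ann (q : tr) (M : tm)          (* q |> M *)
  | Iota (th : fam tm)
  | Clo (M : tm) (s : sub)         (* M[s] *)
  | Er (M : tm)
with tr : Type :=
  | Tr_r
  | Tr_t (q q' : tr)
  | Tr_ba
  | Tr_bb
  | Tr_ti
  | Tr_lam (q : tr)
  | Tr_app (q q' : tr)
  | Tr_let (q q' : tr)
  | Tr_tr (z : fam tr)
  | Tl (M : tm)
with sub : Type :=
  | Id                             (* <> *)
  | Up
  | Cons (M : tm) (s : sub)        (* M . s *)
  | Comp (s t : sub).

(* [ups n] is the (n+1)-fold composition of [Up], associated to the right (the
   orientation of the associativity rule). *)
Fixpoint ups (n : nat) : sub :=
  match n with
  | O => Up
  | S n' => Comp Up (ups n')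
  end.

(* The index n+1: [1] if n = 0, and [1[Up^n]] if n >= 1. *)
Definition var (n : nat) : tm :=
  match n with
  | O => One
  | S n' => Clo One (ups n')
  end.

(** Sigma- and tau-rules. *)

(* Each rule for [er] and [tl] on [var n] covers the two rules for [1] and for
   [1[Up^n]]. *)
Inductive sigma_tm : relation tm :=
  | sg_one_id : sigma_tm (Clo One Id) One
  | sg_one_cons M s : sigma_tm (Clo One (Cons M s)) M
  | sg_lam M s :
      sigma_tm (Clo (Lam M) s) (Lam (Clo M (Cons One (Comp s Up))))
  | sg_app M N s : sigma_tm (Clo (App M N) s) (App (Clo M s) (Clo N s))
  | sg_bang q M s : sigma_tm (Clo (Bang q M) s) (Bang q (Clo M s))
  | sg_let M N s :
      sigma_tm (Clo (Let M N) s)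
               (Let (Clo M s) (Clo N (Cons One (Comp s Up))))
  | sg_ann q M s : sigma_tm (Clo (Ann q M) s) (Ann q (Clo M s))
  | sg_iota th s :
      sigma_tm (Clo (Iota th) s) (Iota (fam_map (fun M => Clo M s) th))
  | sg_clo M s t : sigma_tm (Clo (Clo M s) t) (Clo M (Comp s t))
  | sg_er_var n : sigma_tm (Er (var n)) (var n)
  | sg_er_lam M : sigma_tm (Er (Lam M)) (Lam (Er M))
  | sg_er_app M N : sigma_tm (Er (App M N)) (App (Er M) (Er N))
  | sg_er_bang q M : sigma_tm (Er (Bang q M)) (Bang q M)
  | sg_er_let M N : sigma_tm (Er (Let M N)) (Let (Er M) (Er N))
  | sg_er_ann q M : sigma_tm (Er (Ann q M)) (Er M)
  | sg_er_iota th : sigma_tm (Er (Iota th)) (Iota (fam_map Er th)).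

Inductive sigma_tr : relation tr :=
  | sg_tl_var n : sigma_tr (Tl (var n)) Tr_r
  | sg_tl_lam M : sigma_tr (Tl (Lam M)) (Tr_lam (Tl M))
  | sg_tl_app M N : sigma_tr (Tl (App M N)) (Tr_app (Tl M) (Tl N))
  | sg_tl_bang q M : sigma_tr (Tl (Bang q M)) Tr_r
  | sg_tl_let M N : sigma_tr (Tl (Let M N)) (Tr_let (Tl M) (Tl N))
  | sg_tl_ann q M : sigma_tr (Tl (Ann q M)) (Tr_t q (Tl M))
  | sg_tl_iota th : sigma_tr (Tl (Iota th)) (Tr_tr (fam_map Tl th)).

Inductive sigma_sub : relation sub :=
  | sg_id_comp s : sigma_sub (Comp Id s) s
  | sg_up_id : sigma_sub (Comp Up Id) Up
  | sg_up_cons M s : sigma_sub (Comp Up (Cons M s)) s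
  | sg_cons_comp M s t :
      sigma_sub (Comp (Cons M s) t) (Cons (Clo M t) (Comp s t))
  | sg_comp_assoc s1 s2 s3 :
      sigma_sub (Comp (Comp s1 s2) s3) (Comp s1 (Comp s2 s3)).

Inductive tau_tm : relation tm :=
  | ta_ann_r M : tau_tm (Ann Tr_r M) M
  | ta_ann_ann q q' M : tau_tm (Ann q (Ann q' M)) (Ann (Tr_t q q') M)
  | ta_bang q q' M : tau_tm (Bang q (Ann q' M)) (Bang (Tr_t q q') M)
  | ta_lam q M : tau_tm (Lam (Ann q M)) (Ann (Tr_lam q) (Lam M))
  | ta_app_l q M N :
      tau_tm (App (Ann q M) N) (Ann (Tr_app q Tr_r) (App M N))
  | ta_app_r q M N :
      tau_tm (App M (Ann q N)) (Ann (Tr_app Tr_r q) (App M N))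
  | ta_let_l q M N :
      tau_tm (Let (Ann q M) N) (Ann (Tr_let q Tr_r) (Let M N))
  | ta_let_r q M N :
      tau_tm (Let M (Ann q N)) (Ann (Tr_let Tr_r q) (Let M N))
  | ta_iota th b q M :
      tau_tm (Iota (put th b (Ann q M)))
             (Ann (Tr_tr (put (fam_const Tr_r) b q)) (Iota (put th b M))).

Inductive tau_tr : relation tr :=
  | ta_t_r q : tau_tr (Tr_t q Tr_r) q
  | ta_r_t q : tau_tr (Tr_t Tr_r q) q
  | ta_tr_r : tau_tr (Tr_tr (fam_const Tr_r)) Tr_r
  | ta_app_rr : tau_tr (Tr_app Tr_r Tr_r) Tr_r
  | ta_lam_r : tau_tr (Tr_lam Tr_r) Tr_r
  | ta_let_rr : tau_tr (Tr_let Tr_r Tr_r) Tr_r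
  | ta_t_assoc q1 q2 q3 :
      tau_tr (Tr_t (Tr_t q1 q2) q3) (Tr_t q1 (Tr_t q2 q3))
  | ta_t_lam q q' :
      tau_tr (Tr_t (Tr_lam q) (Tr_lam q')) (Tr_lam (Tr_t q q'))
  | ta_t_lam_t q1 q1' q :
      tau_tr (Tr_t (Tr_lam q1) (Tr_t (Tr_lam q1') q))
             (Tr_t (Tr_lam (Tr_t q1 q1')) q)
  | ta_t_app q1 q2 q1' q2' :
      tau_tr (Tr_t (Tr_app q1 q2) (Tr_app q1' q2'))
             (Tr_app (Tr_t q1 q1') (Tr_t q2 q2'))
  | ta_t_app_t q1 q2 q1' q2' q :
      tau_tr (Tr_t (Tr_app q1 q2) (Tr_t (Tr_app q1' q2') q))
             (Tr_t (Tr_app (Tr_t q1 q1') (Tr_t q2 q2')) q)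
  | ta_t_let q1 q2 q1' q2' :
      tau_tr (Tr_t (Tr_let q1 q2) (Tr_let q1' q2'))
             (Tr_let (Tr_t q1 q1') (Tr_t q2 q2'))
  | ta_t_let_t q1 q2 q1' q2' q :
      tau_tr (Tr_t (Tr_let q1 q2) (Tr_t (Tr_let q1' q2') q))
             (Tr_t (Tr_let (Tr_t q1 q1') (Tr_t q2 q2')) q)
  | ta_t_tr z z' :
      tau_tr (Tr_t (Tr_tr z) (Tr_tr z')) (Tr_tr (fam_map2 Tr_t z z'))
  | ta_t_tr_t z z' q :
      tau_tr (Tr_t (Tr_tr z) (Tr_t (Tr_tr z') q))
             (Tr_t (Tr_tr (fam_map2 Tr_t z z')) q).

(* Rules "apply anywhere": the compatible closure over all three syntactic
   sorts, including inside trails, substitutions, [er] and [tl]. *)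
Section Compatible.
Variables (Rtm : relation tm) (Rtr : relation tr) (Rsub : relation sub).

Inductive cl_tm : relation tm :=
  | cl_tm_root M M' : Rtm M M' -> cl_tm M M'
  | cl_Lam M M' : cl_tm M M' -> cl_tm (Lam M) (Lam M')
  | cl_App_l M M' N : cl_tm M M' -> cl_tm (App M N) (App M' N)
  | cl_App_r M N N' : cl_tm N N' -> cl_tm (App M N) (App M N')
  | cl_Let_l M M' N : cl_tm M M' -> cl_tm (Let M N) (Let M' N)
  | cl_Let_r M N N' : cl_tm N N' -> cl_tm (Let M N) (Let M N')
  | cl_Bang_l q q' M : cl_tr q q' -> cl_tm (Bang q M) (Bang q' M)
  | cl_Bang_r q M M' : cl_tm M M' -> cl_tm (Bang q M) (Bang q M')
  | cl_Ann_l q q' M : cl_tr q q' -> cl_tm (Ann q M) (Ann q' M)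
  | cl_Ann_r q M M' : cl_tm M M' -> cl_tm (Ann q M) (Ann q M')
  | cl_Iota th b M M' :
      cl_tm M M' -> cl_tm (Iota (put th b M)) (Iota (put th b M'))
  | cl_Clo_l M M' s : cl_tm M M' -> cl_tm (Clo M s) (Clo M' s)
  | cl_Clo_r M s s' : cl_sub s s' -> cl_tm (Clo M s) (Clo M s')
  | cl_Er M M' : cl_tm M M' -> cl_tm (Er M) (Er M')
with cl_tr : relation tr :=
  | cl_tr_root q q' : Rtr q q' -> cl_tr q q'
  | cl_t_l q1 q1' q2 : cl_tr q1 q1' -> cl_tr (Tr_t q1 q2) (Tr_t q1' q2)
  | cl_t_r q1 q2 q2' : cl_tr q2 q2' -> cl_tr (Tr_t q1 q2) (Tr_t q1 q2')
  | cl_lam q q' : cl_tr q q' -> cl_tr (Tr_lam q) (Tr_lam q')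
  | cl_app_l q1 q1' q2 : cl_tr q1 q1' -> cl_tr (Tr_app q1 q2) (Tr_app q1' q2)
  | cl_app_r q1 q2 q2' : cl_tr q2 q2' -> cl_tr (Tr_app q1 q2) (Tr_app q1 q2')
  | cl_let_l q1 q1' q2 : cl_tr q1 q1' -> cl_tr (Tr_let q1 q2) (Tr_let q1' q2)
  | cl_let_r q1 q2 q2' : cl_tr q2 q2' -> cl_tr (Tr_let q1 q2) (Tr_let q1 q2')
  | cl_trf z b q q' :
      cl_tr q q' -> cl_tr (Tr_tr (put z b q)) (Tr_tr (put z b q'))
  | cl_Tl M M' : cl_tm M M' -> cl_tr (Tl M) (Tl M')
with cl_sub : relation sub :=
  | cl_sub_root s s' : Rsub s s' -> cl_sub s s'
  | cl_Cons_l M M' s : cl_tm M M' -> cl_sub (Cons M s) (Cons M' s)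
  | cl_Cons_r M s s' : cl_sub s s' -> cl_sub (Cons M s) (Cons M s')
  | cl_Comp_l s s' t : cl_sub s s' -> cl_sub (Comp s t) (Comp s' t)
  | cl_Comp_r s t t' : cl_sub t t' -> cl_sub (Comp s t) (Comp s t').

End Compatible.

Definition sigmatau_tm : relation tm :=
  cl_tm (union tm sigma_tm tau_tm) (union tr sigma_tr tau_tr) sigma_sub.

Definition sigmatau_tr : relation tr :=
  cl_tr (union tm sigma_tm tau_tm) (union tr sigma_tr tau_tr) sigma_sub.

Definition tau_step : relation tm :=
  cl_tm tau_tm tau_tr (fun _ _ => False).

(* [sigmatau_equiv] is the equivalence closure, on terms. *)
Definition sigmatau_equiv : relation tm := clos_refl_sym_trans tm sigmatau_tm.

(* [normal_form_of R x y]: y is a normal form of x.  For the terminating and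
   confluent relations above this is the graph of the normal-form function. *)
Definition normal_form_of (A : Type) (R : relation A) (x y : A) : Prop :=
  clos_refl_trans A R x y /\ forall z, ~ R y z.

(** Inspection. *)

Definition app_fam (M : tm) (f : fam tm) : tm :=
  App (App (App (App (App (App (App (App (App M
    (f_r f)) (f_t f)) (f_ba f)) (f_bb f)) (f_ti f))
    (f_lam f)) (f_app f)) (f_let f)) (f_tr f).

(* Meaningful on [tl]-free trails; the [Tl] branch is a dummy value, never
   reached from a sigma-tau-normal trail nor from a trail of CAU^-. *)
Fixpoint inspect (th : fam tm) (q : tr) : tm :=
  match q with
  | Tr_r => f_r th
  | Tr_t q1 q2 => App (App (f_t th) (inspect th q1)) (inspect th q2)
  | Tr_ba => f_ba th
  | Tr_bb => f_bb th
  | Tr_ti => f_ti th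
  | Tr_lam q1 => App (f_lam th) (inspect th q1)
  | Tr_app q1 q2 => App (App (f_app th) (inspect th q1)) (inspect th q2)
  | Tr_let q1 q2 => App (App (f_let th) (inspect th q1)) (inspect th q2)
  | Tr_tr z => app_fam (f_tr th) (fam_map (inspect th) z)
  | Tl _ => One
  end.

(** The calculus CAU^-_sigma. *)

(* Bang-free contexts F of CAU^-_sigma. *)
Inductive fctx_sigma : Type :=
  | FS_hole
  | FS_lam (F : fctx_sigma)
  | FS_app_l (F : fctx_sigma) (N : tm)
  | FS_app_r (M : tm) (F : fctx_sigma)
  | FS_let_l (F : fctx_sigma) (N : tm)
  | FS_let_r (M : tm) (F : fctx_sigma)
  | FS_ann (q : tr) (F : fctx_sigma)
  | FS_iota (th : fam tm) (b : branch) (F : fctx_sigma)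
  | FS_clo (F : fctx_sigma) (s : sub).

Fixpoint plug_sigma (F : fctx_sigma) (P : tm) : tm :=
  match F with
  | FS_hole => P
  | FS_lam F => Lam (plug_sigma F P)
  | FS_app_l F N => App (plug_sigma F P) N
  | FS_app_r M F => App M (plug_sigma F P)
  | FS_let_l F N => Let (plug_sigma F P) N
  | FS_let_r M F => Let M (plug_sigma F P)
  | FS_ann q F => Ann q (plug_sigma F P)
  | FS_iota th b F => Iota (put th b (plug_sigma F P))
  | FS_clo F s => Clo (plug_sigma F P) s
  end.

Inductive Beta_root : relation tm :=
  | Beta_lam M N :
      Beta_root (App (Lam M) N)
        (Ann (Tr_t (Tr_app (Tr_lam (Tl M)) (Tl N)) Tr_ba)
             (Clo (Er M) (Cons (Er N) Id)))
  | Beta_let q M N :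
      Beta_root (Let (Bang q M) N)
        (Ann (Tr_t (Tr_let Tr_r (Tl N)) Tr_bb)
             (Clo (Er N) (Cons (Ann q M) Id)))
  | Beta_iota q F th q' :
      normal_form_of sigmatau_tr
        (Tr_t q (Tl (plug_sigma F (Iota th)))) q' ->
      Beta_root (Bang q (plug_sigma F (Iota th)))
        (Bang q (plug_sigma F (Ann Tr_ti (inspect th q')))).

(* Closure under the contexts E_sigma ([Beta]) and S_sigma ([Beta_sub]): one
   rule per production, hence none for [Er] or inside trails. *)
Inductive Beta : relation tm :=
  | Be_root M M' : Beta_root M M' -> Beta M M'
  | Be_lam M M' : Beta M M' -> Beta (Lam M) (Lam M')
  | Be_app_l M M' N : Beta M M' -> Beta (App M N) (App M' N)
  | Be_app_r M N N' : Beta N N' -> Beta (App M N) (App M N')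
  | Be_let_l M M' N : Beta M M' -> Beta (Let M N) (Let M' N)
  | Be_let_r M N N' : Beta N N' -> Beta (Let M N) (Let M N')
  | Be_bang q M M' : Beta M M' -> Beta (Bang q M) (Bang q M')
  | Be_ann q M M' : Beta M M' -> Beta (Ann q M) (Ann q M')
  | Be_iota th b M M' :
      Beta M M' -> Beta (Iota (put th b M)) (Iota (put th b M'))
  | Be_clo_l M M' s : Beta M M' -> Beta (Clo M s) (Clo M' s)
  | Be_clo_r M s s' : Beta_sub s s' -> Beta (Clo M s) (Clo M s')
with Beta_sub : relation sub :=
  | Be_comp_l s s' t : Beta_sub s s' -> Beta_sub (Comp s t) (Comp s' t)
  | Be_comp_r s t t' : Beta_sub t t' -> Beta_sub (Comp s t) (Comp s t')
  | Be_cons_l M M' s : Beta M M' -> Beta_sub (Cons M s) (Cons M' s)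
  | Be_cons_r M s s' : Beta_sub s s' -> Beta_sub (Cons M s) (Cons M s').

Definition cau_sigma_step : relation tm := union tm Beta sigmatau_equiv.

(** The calculus CAU^-: the terms of the shared syntax whose only closures are
    the indices [1[Up^n]] and whose trails do not contain [tl]. *)

Inductive cau_tr : tr -> Prop :=
  | cau_r : cau_tr Tr_r
  | cau_t q q' : cau_tr q -> cau_tr q' -> cau_tr (Tr_t q q')
  | cau_ba : cau_tr Tr_ba
  | cau_bb : cau_tr Tr_bb
  | cau_ti : cau_tr Tr_ti
  | cau_lam q : cau_tr q -> cau_tr (Tr_lam q)
  | cau_app q q' : cau_tr q -> cau_tr q' -> cau_tr (Tr_app q q')
  | cau_let q q' : cau_tr q -> cau_tr q' -> cau_tr (Tr_let q q')
  | cau_trf z : (forall b, cau_tr (get z b)) -> cau_tr (Tr_tr z).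

Inductive cau_tm : tm -> Prop :=
  | cau_var n : cau_tm (var n)
  | cau_Lam M : cau_tm M -> cau_tm (Lam M)
  | cau_App M N : cau_tm M -> cau_tm N -> cau_tm (App M N)
  | cau_Let M N : cau_tm M -> cau_tm N -> cau_tm (Let M N)
  | cau_Bang q M : cau_tr q -> cau_tm M -> cau_tm (Bang q M)
  | cau_Ann q M : cau_tr q -> cau_tm M -> cau_tm (Ann q M)
  | cau_Iota th : (forall b, cau_tm (get th b)) -> cau_tm (Iota th).

(* [unups (ups n) = Some n], and [None] outside the image of [ups]. *)
Fixpoint unups (s : sub) : option nat :=
  match s with
  | Up => Some O
  | Comp Up s' => option_map S (unups s')
  | _ => None
  end.

(* Renaming and substitution on CAU^- terms, at binding depth k (variables
   counted from 0, i.e. [var n] is the index n+1).  Trails of CAU^- contain no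
   terms and are left alone.  The values on closures other than indices and on
   [Er], which are not CAU^- terms, are irrelevant. *)
Definition lift_var (k n : nat) : tm :=
  if Nat.ltb n k then var n else var (S n).

Fixpoint lift (k : nat) (M : tm) : tm :=
  match M with
  | One => lift_var k 0
  | Lam M => Lam (lift (S k) M)
  | App M N => App (lift k M) (lift k N)
  | Let M N => Let (lift k M) (lift (S k) N)
  | Bang q M => Bang q (lift k M)
  | Ann q M => Ann q (lift k M)
  | Iota th => Iota (fam_map (lift k) th)
  | Clo One s =>
      match unups s with Some n => lift_var k (S n) | None => M end
  | Clo _ _ | Er _ => M
  end.

Definition subst_var (k : nat) (P : tm) (n : nat) : tm :=
  match Nat.compare n k with
  | Lt => var n
  | Eq => P
  | Gt => var (pred n)
  end.

Fixpoint subst (k : nat) (P M : tm) : tm :=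
  match M with
  | One => subst_var k P 0
  | Lam M => Lam (subst (S k) (lift 0 P) M)
  | App M N => App (subst k P M) (subst k P N)
  | Let M N => Let (subst k P M) (subst (S k) (lift 0 P) N)
  | Bang q M => Bang q (subst k P M)
  | Ann q M => Ann q (subst k P M)
  | Iota th => Iota (fam_map (subst k P) th)
  | Clo One s =>
      match unups s with Some n => subst_var k P (S n) | None => M end
  | Clo _ _ | Er _ => M
  end.

(* M{N} *)
Definition subst1 (M N : tm) : tm := subst 0 N M.

(* Bang-free contexts F of CAU^-. *)
Inductive fctx : Type :=
  | F_hole
  | F_lam (F : fctx)
  | F_app_l (F : fctx) (N : tm)
  | F_app_r (M : tm) (F : fctx)
  | F_let_l (F : fctx) (N : tm)
  | F_let_r (M : tm) (F : fctx)
  | F_ann (q : tr) (F : fctx)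
  | F_iota (th : fam tm) (b : branch) (F : fctx).

Fixpoint plug (F : fctx) (P : tm) : tm :=
  match F with
  | F_hole => P
  | F_lam F => Lam (plug F P)
  | F_app_l F N => App (plug F P) N
  | F_app_r M F => App M (plug F P)
  | F_let_l F N => Let (plug F P) N
  | F_let_r M F => Let M (plug F P)
  | F_ann q F => Ann q (plug F P)
  | F_iota th b F => Iota (put th b (plug F P))
  end.

Inductive beta_root : relation tm :=
  | beta_lam M N : beta_root (App (Lam M) N) (Ann Tr_ba (subst1 M N))
  | beta_let q M N :
      beta_root (Let (Bang q M) N) (Ann Tr_bb (subst1 N (Ann q M)))
  | beta_iota q F th :
      beta_root (Bang q (plug F (Iota th)))
                (Bang q (plug F (Ann Tr_ti (inspect th q)))).

(* Closure under the contexts E, one rule per production. *)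
Inductive beta : relation tm :=
  | be_root M M' : beta_root M M' -> beta M M'
  | be_lam M M' : beta M M' -> beta (Lam M) (Lam M')
  | be_app_l M M' N : beta M M' -> beta (App M N) (App M' N)
  | be_app_r M N N' : beta N N' -> beta (App M N) (App M N')
  | be_let_l M M' N : beta M M' -> beta (Let M N) (Let M' N)
  | be_let_r M N N' : beta N N' -> beta (Let M N) (Let M N')
  | be_bang q M M' : beta M M' -> beta (Bang q M) (Bang q M')
  | be_ann q M M' : beta M M' -> beta (Ann q M) (Ann q M')
  | be_iota th b M M' :
      beta M M' -> beta (Iota (put th b M)) (Iota (put th b M')).

(* Only the source need be required to be a CAU^- term: [beta] and [tau_step]
   preserve this. *)
Definition cau_step : relation tm := fun M P =>
  cau_tm M /\ exists N, beta M N /\ normal_form_of tau_step N P.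

Definition joinable (A : Type) (R : relation A) (x y : A) : Prop :=
  exists z, clos_refl_trans A R x z /\ clos_refl_trans A R y z.

(* Main.v *)
(** Along a CAU^- reduction starting from a sigma-tau-normal form every term
    is tau-normal.  In a tau-normal CAU^- redex no trail annotation is exposed
    outside the bangs, so erasure is the identity and the extracted trails are
    trivial up to sigma-tau; a CAU^- contraction followed by tau-normalization
    is then one Beta step followed by a sigma-tau equivalence. *)

Require Import Defs.
From Stdlib Require Import Relations Morphisms Setoid Arith Lia.

Set Implicit Arguments.

Open Scope signature_scope.

(** * Sigma-tau equivalence as a congruence on terms, trails and substitutions *)

Definition sigmatau_sub : relation sub :=
  cl_sub (union tm sigma_tm tau_tm) (union tr sigma_tr tau_tr) sigma_sub.

Definition sigmatau_equiv_tr : relation tr := clos_refl_sym_trans tr sigmatau_tr.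
Definition sigmatau_equiv_sub : relation sub :=
  clos_refl_sym_trans sub sigmatau_sub.

Infix "==" := sigmatau_equiv (at level 70).
Infix "=t=" := sigmatau_equiv_tr (at level 70).
Infix "=s=" := sigmatau_equiv_sub (at level 70).

Definition normal (A : Type) (R : relation A) (x : A) : Prop :=
  forall y, ~ R x y.

Lemma rt_map (A B : Type) (R : relation A) (S : relation B) (f : A -> B) :
  (forall x y, R x y -> S (f x) (f y)) ->
  forall x y, clos_refl_trans A R x y -> clos_refl_trans B S (f x) (f y).
Proof.
  intros Hf x y H; induction H; [apply rt_step | apply rt_refl | eapply rt_trans];
    eauto.
Qed.

Lemma rst_map (A B : Type) (R : relation A) (S : relation B) (f : A -> B) :
  (forall x y, R x y -> S (f x) (f y)) ->
  forall x y, clos_refl_sym_trans A R x y -> clos_refl_sym_trans B S (f x) (f y).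
Proof.
  intros Hf x y H; induction H;
    [apply rst_step | apply rst_refl | apply rst_sym | eapply rst_trans]; eauto.
Qed.

Lemma rt_map2 (A B C : Type) (R : relation A) (R' : relation B)
    (S : relation C) (f : A -> B -> C) :
  (forall x y z, R x y -> S (f x z) (f y z)) ->
  (forall x y z, R' x y -> S (f z x) (f z y)) ->
  forall x x' y y', clos_refl_trans A R x x' -> clos_refl_trans B R' y y' ->
  clos_refl_trans C S (f x y) (f x' y').
Proof.
  intros H1 H2 x x' y y' Hx Hy; apply rt_trans with (f x' y).
  - revert Hx; apply (rt_map _ (fun x => f x y)); auto.
  - revert Hy; apply (rt_map _ (f x')); auto.
Qed.

(** The [Proper] form makes each binary constructor an instance at once, so that sigma-tau
    equivalences can be rewritten under it. *)
Lemma rst_map2 (A B C : Type) (R : relation A) (R' : relation B)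
    (S : relation C) (f : A -> B -> C) :
  (forall x y z, R x y -> S (f x z) (f y z)) ->
  (forall x y z, R' x y -> S (f z x) (f z y)) ->
  Proper (clos_refl_sym_trans A R ==> clos_refl_sym_trans B R' ==>
          clos_refl_sym_trans C S) f.
Proof.
  intros H1 H2 x x' Hx y y' Hy; apply rst_trans with (f x' y).
  - revert Hx; apply (rst_map _ (fun x => f x y)); auto.
  - revert Hy; apply (rst_map _ (f x')); auto.
Qed.

#[local] Instance sigmatau_equiv_Equivalence : Equivalence sigmatau_equiv.
Proof.
  split; red; [apply rst_refl | apply rst_sym | apply rst_trans].
Qed.

#[local] Instance sigmatau_equiv_tr_Equivalence : Equivalence sigmatau_equiv_tr.
Proof.
  split; red; [apply rst_refl | apply rst_sym | apply rst_trans].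
Qed.

#[local] Instance sigmatau_equiv_sub_Equivalence : Equivalence sigmatau_equiv_sub.
Proof.
  split; red; [apply rst_refl | apply rst_sym | apply rst_trans].
Qed.

#[local] Instance Lam_Proper : Proper (sigmatau_equiv ==> sigmatau_equiv) Lam.
Proof. intros x y; apply (rst_map _ Lam); intros; constructor; assumption. Qed.

#[local] Instance App_Proper :
  Proper (sigmatau_equiv ==> sigmatau_equiv ==> sigmatau_equiv) App.
Proof. apply rst_map2; intros; constructor; assumption. Qed.

#[local] Instance Let_Proper :
  Proper (sigmatau_equiv ==> sigmatau_equiv ==> sigmatau_equiv) Let.
Proof. apply rst_map2; intros; constructor; assumption. Qed.

#[local] Instance Bang_Proper :
  Proper (sigmatau_equiv_tr ==> sigmatau_equiv ==> sigmatau_equiv) Bang.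
Proof. apply rst_map2; intros; constructor; assumption. Qed.

#[local] Instance Ann_Proper :
  Proper (sigmatau_equiv_tr ==> sigmatau_equiv ==> sigmatau_equiv) Ann.
Proof. apply rst_map2; intros; constructor; assumption. Qed.

#[local] Instance Clo_Proper :
  Proper (sigmatau_equiv ==> sigmatau_equiv_sub ==> sigmatau_equiv) Clo.
Proof. apply rst_map2; intros; constructor; assumption. Qed.

#[local] Instance Cons_Proper :
  Proper (sigmatau_equiv ==> sigmatau_equiv_sub ==> sigmatau_equiv_sub) Cons.
Proof. apply rst_map2; intros; constructor; assumption. Qed.

#[local] Instance Comp_Proper :
  Proper (sigmatau_equiv_sub ==> sigmatau_equiv_sub ==> sigmatau_equiv_sub) Comp.
Proof. apply rst_map2; intros; constructor; assumption. Qed.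

#[local] Instance Tr_t_Proper :
  Proper (sigmatau_equiv_tr ==> sigmatau_equiv_tr ==> sigmatau_equiv_tr) Tr_t.
Proof. apply rst_map2; intros; constructor; assumption. Qed.

#[local] Instance Tr_app_Proper :
  Proper (sigmatau_equiv_tr ==> sigmatau_equiv_tr ==> sigmatau_equiv_tr) Tr_app.
Proof. apply rst_map2; intros; constructor; assumption. Qed.

#[local] Instance Tr_let_Proper :
  Proper (sigmatau_equiv_tr ==> sigmatau_equiv_tr ==> sigmatau_equiv_tr) Tr_let.
Proof. apply rst_map2; intros; constructor; assumption. Qed.

#[local] Instance Tr_lam_Proper :
  Proper (sigmatau_equiv_tr ==> sigmatau_equiv_tr) Tr_lam.
Proof. intros x y; apply (rst_map _ Tr_lam); intros; constructor; assumption. Qed.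

Lemma sigma_step_tm M N : sigma_tm M N -> sigmatau_tm M N.
Proof. intros H; apply cl_tm_root; left; exact H. Qed.

Lemma sigma_step_tr q q' : sigma_tr q q' -> sigmatau_tr q q'.
Proof. intros H; apply cl_tr_root; left; exact H. Qed.

Lemma tau_step_tr q q' : tau_tr q q' -> sigmatau_tr q q'.
Proof. intros H; apply cl_tr_root; right; exact H. Qed.

Lemma sigma_equiv_tm M N : sigma_tm M N -> M == N.
Proof. intros H; apply rst_step, sigma_step_tm, H. Qed.

Lemma tau_equiv_tr q q' : tau_tr q q' -> q =t= q'.
Proof. intros H; apply rst_step, tau_step_tr, H. Qed.

Lemma sigma_equiv_sub s t : sigma_sub s t -> s =s= t.
Proof. intros H; apply rst_step, cl_sub_root, H. Qed.

(** * Families and the compatible closure *)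

Lemma get_put_eq (A : Type) (f : fam A) b x : get (put f b x) b = x.
Proof. destruct b; reflexivity. Qed.

Lemma put_get (A : Type) (f : fam A) b : put f b (get f b) = f.
Proof. destruct f, b; reflexivity. Qed.

Lemma get_fam_map (A B : Type) (g : A -> B) (f : fam A) b :
  get (fam_map g f) b = g (get f b).
Proof. destruct b; reflexivity. Qed.

Scheme cl_tm_mind := Minimality for cl_tm Sort Prop
  with cl_tr_mind := Minimality for cl_tr Sort Prop
  with cl_sub_mind := Minimality for cl_sub Sort Prop.

(** A tau-step on a term may take place inside a trail or a substitution, so the induction runs over
    the three closures simultaneously. *)
Lemma tau_step_sigmatau M N : tau_step M N -> sigmatau_tm M N.
Proof.
  revert M N.
  apply (@cl_tm_mind tau_tm tau_tr (fun _ _ => False)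
           sigmatau_tm sigmatau_tr sigmatau_sub);
    try (intros; constructor; assumption).
  - intros; apply cl_tm_root; right; assumption.
  - intros; apply cl_tr_root; right; assumption.
  - intros ? ? [].
Qed.

(** The nine components are replaced one after the other, and the nine resulting instances of [S]
    are chained by transitivity. *)
Lemma fam_lift (A B : Type) (R : relation A) (S : relation B) (c : fam A -> B) :
  Transitive S ->
  (forall f b x y, R x y -> S (c (put f b x)) (c (put f b y))) ->
  forall f f', (forall b, R (get f b) (get f' b)) -> S (c f) (c f').
Proof.
  intros HS Hc f f' H.
  (* [g] is an intermediate family: some components are already those of [f'], but position [b]
     still holds that of [f]. *)
  assert (Hput : forall b g, get g b = get f b ->
            S (c g) (c (put g b (get f' b)))).
  { intros b g Hg; rewrite <- (put_get g b) at 1; rewrite Hg.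
    apply Hc, H. }
  destruct f as [x1 x2 x3 x4 x5 x6 x7 x8 x9],
    f' as [y1 y2 y3 y4 y5 y6 y7 y8 y9].
  etransitivity; [apply (Hput b_r); reflexivity | cbn].
  etransitivity; [apply (Hput b_t); reflexivity | cbn].
  etransitivity; [apply (Hput b_ba); reflexivity | cbn].
  etransitivity; [apply (Hput b_bb); reflexivity | cbn].
  etransitivity; [apply (Hput b_ti); reflexivity | cbn].
  etransitivity; [apply (Hput b_lam); reflexivity | cbn].
  etransitivity; [apply (Hput b_app); reflexivity | cbn].
  etransitivity; [apply (Hput b_let); reflexivity | cbn].
  apply (Hput b_tr); reflexivity.
Qed.

Lemma Iota_put_equiv th b M M' :
  M == M' -> Iota (put th b M) == Iota (put th b M').
Proof.
  apply (rst_map _ (fun M => Iota (put th b M))); intros; apply cl_Iota; assumption.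
Qed.

Lemma Iota_equiv th th' :
  (forall b, get th b == get th' b) -> Iota th == Iota th'.
Proof. apply (fam_lift _ Iota); [exact _ | exact Iota_put_equiv]. Qed.

Lemma Iota_rt th th' :
  (forall b, clos_refl_trans tm sigmatau_tm (get th b) (get th' b)) ->
  clos_refl_trans tm sigmatau_tm (Iota th) (Iota th').
Proof.
  apply (fam_lift _ Iota); [red; apply rt_trans |].
  intros f b; apply (rt_map _ (fun M => Iota (put f b M))).
  intros; apply cl_Iota; assumption.
Qed.

Lemma Tr_tr_rt z z' :
  (forall b, clos_refl_trans tr sigmatau_tr (get z b) (get z' b)) ->
  clos_refl_trans tr sigmatau_tr (Tr_tr z) (Tr_tr z').
Proof.
  apply (fam_lift _ Tr_tr); [red; apply rt_trans |].
  intros f b; apply (rt_map _ (fun q => Tr_tr (put f b q))).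
  intros; apply cl_trf; assumption.
Qed.

(** * Explicit substitutions on CAU^- terms *)

Lemma unups_ups n : unups (ups n) = Some n.
Proof. induction n as [| n IH]; cbn; [| rewrite IH]; reflexivity. Qed.

Lemma lift_eq_var k n : lift k (var n) = lift_var k n.
Proof. destruct n; cbn; [| rewrite unups_ups]; reflexivity. Qed.

Lemma subst_eq_var k P n : subst k P (var n) = subst_var k P n.
Proof. destruct n; cbn; [| rewrite unups_ups]; reflexivity. Qed.

(** Crossing a binder raises depth and index together, so their comparison has the same outcome and
    the result is shifted by one. *)
Lemma lift_var_S k n : lift_var (S k) (S n) = lift 0 (lift_var k n).
Proof.
  unfold lift_var; change (Nat.ltb (S n) (S k)) with (Nat.ltb n k).
  destruct (Nat.ltb n k); rewrite lift_eq_var; reflexivity.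
Qed.

Lemma subst_var_S k P n :
  subst_var (S k) (lift 0 P) (S n) = lift 0 (subst_var k P n).
Proof.
  unfold subst_var; cbn [Nat.compare].
  destruct (Nat.compare_spec n k); rewrite ?lift_eq_var; try reflexivity.
  (* Here [k < n], so [n] is nonzero and the truncated [pred n] is a true predecessor. *)
  destruct n; [lia | reflexivity].
Qed.

Lemma cau_lift_var k n : cau_tm (lift_var k n).
Proof. unfold lift_var; destruct (Nat.ltb n k); apply cau_var. Qed.

Lemma cau_lift M : cau_tm M -> forall k, cau_tm (lift k M).
Proof.
  induction 1; intros k; try (cbn; constructor; auto; fail).
  - rewrite lift_eq_var; apply cau_lift_var.
  - cbn [lift]; constructor; intros b; rewrite get_fam_map; auto.
Qed.

Lemma cau_subst_var k P n : cau_tm P -> cau_tm (subst_var k P n).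
Proof.
  intros HP; unfold subst_var; destruct (Nat.compare n k);
    [exact HP | apply cau_var | apply cau_var].
Qed.

(** This is the form that [s] takes under a binder in the rules [sg_lam] and [sg_let]. *)
Definition up (s : sub) : sub := Cons One (Comp s Up).

(** [ups] adds shifts on the left; associativity moves the one added on the right inwards. *)
Lemma ups_Comp_Up n : Comp (ups n) Up =s= ups (S n).
Proof.
  induction n as [| n IH]; [reflexivity |].
  cbn [ups] in *; rewrite (sigma_equiv_sub (sg_comp_assoc _ _ _)), IH; reflexivity.
Qed.

Lemma var_Up n : Clo (var n) Up == var (S n).
Proof.
  destruct n as [| n]; [reflexivity |]; cbn [var].
  rewrite (sigma_equiv_tm (sg_clo _ _ _)), ups_Comp_Up; reflexivity.
Qed.

Lemma var_Cons n M s : Clo (var (S n)) (Cons M s) == Clo (var n) s.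
Proof.
  (* Reading the index backwards as a shifted [var n] exposes [Comp Up (Cons M s)], where the shift
     discards the head. *)
  rewrite <- var_Up, (sigma_equiv_tm (sg_clo _ _ _)),
    (sigma_equiv_sub (sg_up_cons _ _)); reflexivity.
Qed.

Lemma var_up n s : Clo (var (S n)) (up s) == Clo (Clo (var n) s) Up.
Proof.
  unfold up; rewrite var_Cons, (sigma_equiv_tm (sg_clo _ _ _)); reflexivity.
Qed.

(** The sigma-rules cancel a final [Id] only after a single [Up], so a positive index is first
    rewritten as a shifted one. *)
Lemma var_Id n : Clo (var n) Id == var n.
Proof.
  destruct n as [| n]; [apply sigma_equiv_tm, sg_one_id |].
  rewrite <- var_Up, (sigma_equiv_tm (sg_clo _ _ _)),
    (sigma_equiv_sub sg_up_id); reflexivity.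
Qed.

(* [op] stands for [lift] or [subst]; its parameter [k] is the binding depth,
   and [sb k] the explicit substitution with the same effect on indices. *)
Lemma Clo_traversal (T : Type) (op : T -> tm -> tm) (next : T -> T)
    (sb : T -> sub) :
  (forall k n, Clo (var n) (sb k) == op k (var n)) ->
  (forall k, sb (next k) = up (sb k)) ->
  (forall k M, op k (Lam M) = Lam (op (next k) M)) ->
  (forall k M N, op k (App M N) = App (op k M) (op k N)) ->
  (forall k M N, op k (Let M N) = Let (op k M) (op (next k) N)) ->
  (forall k q M, op k (Bang q M) = Bang q (op k M)) ->
  (forall k q M, op k (Ann q M) = Ann q (op k M)) ->
  (forall k th, op k (Iota th) = Iota (fam_map (op k) th)) ->
  forall M, cau_tm M -> forall k, Clo M (sb k) == op k M.
Proof.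
  intros Hvar Hsb HLam HApp HLet HBang HAnn HIota.
  induction 1 as [n | M _ IHM | M N _ IHM _ IHN | M N _ IHM _ IHN
    | q M _ _ IHM | q M _ _ IHM | th _ IH]; intros k.
  - apply Hvar.
  - rewrite (sigma_equiv_tm (sg_lam _ _)), HLam, <- IHM, Hsb; reflexivity.
  - rewrite (sigma_equiv_tm (sg_app _ _ _)), HApp, <- IHM, <- IHN; reflexivity.
  - rewrite (sigma_equiv_tm (sg_let _ _ _)), HLet, <- IHM, <- IHN, Hsb; reflexivity.
  - rewrite (sigma_equiv_tm (sg_bang _ _ _)), HBang, <- IHM; reflexivity.
  - rewrite (sigma_equiv_tm (sg_ann _ _ _)), HAnn, <- IHM; reflexivity.
  - rewrite (sigma_equiv_tm (sg_iota _ _)), HIota.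
    apply Iota_equiv; intros b; rewrite !get_fam_map; apply IH.
Qed.

Lemma Clo_lift M : cau_tm M -> Clo M Up == lift 0 M.
Proof.
  intros HM.
  (* Below [k] binders the shift has become [up] iterated [k] times on [Up]: it fixes the first [k]
     indices and shifts the others, as [lift k] does. Only this claim about indices needs a
     proof. *)
  refine (Clo_traversal lift S (fun k => Nat.iter k up Up) _ _ _ _ _ _ _ _ HM 0);
    try reflexivity.
  induction k as [| k IH]; intros n; rewrite lift_eq_var; cbn [Nat.iter nat_rect].
  - apply var_Up.
  - destruct n as [| n]; [apply sigma_equiv_tm, sg_one_cons |].
    rewrite var_up, lift_var_S, <- lift_eq_var.
    change (nat_rect (fun _ => sub) Up (fun _ => up) k) with (Nat.iter k up Up).
    rewrite IH, !lift_eq_var; unfold lift_var at 1 2.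
    (* On either side of the comparison the lifted index is again an index, so the outer shift is
       computed by [var_Up]. *)
    destruct (Nat.ltb n k); rewrite var_Up, lift_eq_var; reflexivity.
Qed.

Lemma Clo_subst1 M N : cau_tm M -> cau_tm N -> Clo M (Cons N Id) == subst1 M N.
Proof.
  intros HM HN.
  (* [P k] is [N] as seen from below [k] binders, matching the [lift 0] that [subst] performs at
     each binder. *)
  set (P k := Nat.iter k (lift 0) N).
  refine (Clo_traversal (fun k => subst k (P k)) S
            (fun k => Nat.iter k up (Cons N Id)) _ _ _ _ _ _ _ _ HM 0);
    try reflexivity.
  assert (HP : forall k, cau_tm (P k)).
  { induction k; [exact HN | apply cau_lift; assumption]. }
  induction k as [| k IH]; intros n; rewrite subst_eq_var.
  - destruct n as [| n]; [apply sigma_equiv_tm, sg_one_cons |].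
    cbn [Nat.iter nat_rect]; rewrite var_Cons; apply var_Id.
  - change (P (S k)) with (lift 0 (P k)).
    change (Nat.iter (S k) up (Cons N Id)) with (up (Nat.iter k up (Cons N Id))).
    destruct n as [| n]; [apply sigma_equiv_tm, sg_one_cons |].
    rewrite var_up, subst_var_S, IH, subst_eq_var.
    (* What remains is an explicit shift of the term substituted for the index; the previous lemma
       applies because that term is a CAU^- term. *)
    apply Clo_lift, cau_subst_var, HP.
Qed.

(** * Erasure and extraction on tau-normal CAU^- terms *)

Lemma cau_tr_put z b q : cau_tr (Tr_tr (put z b q)) -> cau_tr q.
Proof.
  inversion 1 as [| | | | | | | | z' Hz]; specialize (Hz b).
  rewrite get_put_eq in Hz; exact Hz.
Qed.

(** Since [var n] is not a constructor, plain inversion would leave an undecided variable case for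
    every shape of [M]; it is settled here once by a case split on [n]. *)
Lemma cau_tm_inv M :
  cau_tm M ->
  match M with
  | Lam M => cau_tm M
  | App M N | Let M N => cau_tm M /\ cau_tm N
  | Bang q M | Ann q M => cau_tr q /\ cau_tm M
  | Iota th => forall b, cau_tm (get th b)
  | _ => True
  end.
Proof. destruct 1 as [n | | | | | |]; auto; destruct n; exact I. Qed.

Lemma cau_tm_put th b M : cau_tm (Iota (put th b M)) -> cau_tm M.
Proof. intros H; rewrite <- (get_put_eq th b M); exact (cau_tm_inv H b). Qed.

(** Every sigma-rule on trails contracts a [Tl], and a trail can contain a term only below [Tl];
    CAU^- trails have none, so only tau-rules can fire. *)
Lemma sigmatau_tr_cau q q' :
  sigmatau_tr q q' -> cau_tr q ->
  cl_tr tau_tm tau_tr (fun _ _ => False) q q'.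
Proof.
  unfold sigmatau_tr; induction 1; intros Hq;
    try (inversion Hq; subst; constructor; auto; fail).
  - destruct H as [H | H]; [destruct H; inversion Hq | apply cl_tr_root, H].
  - apply cl_trf, IHcl_tr, (cau_tr_put Hq).
Qed.

Lemma normal_Iota th :
  normal tau_step (Iota th) -> forall b, normal tau_step (get th b).
Proof.
  intros H b M HM; apply (H (Iota (put th b M))).
  rewrite <- (put_get th b) at 1; apply cl_Iota, HM.
Qed.

Lemma normal_map (f : tm -> tm) :
  (forall M N, tau_step M N -> tau_step (f M) (f N)) ->
  forall M, normal tau_step (f M) -> normal tau_step M.
Proof. intros Hf M H N HN; apply (H (f N)), Hf, HN. Qed.

(** The tau-rules pull annotations outwards, so in a tau-normal CAU^- term an annotation outside the
    bangs can stand only at the root. This predicate excludes that last position. *)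
Definition not_ann (M : tm) : Prop := forall q N, M <> Ann q N.

(** A rule pulling an annotation out of the frame [f], with contractum [g], would fire if the
    immediate subterm were annotated. *)
Lemma normal_not_ann (f : tm -> tm) (g : tr -> tm -> tm) :
  (forall q M, tau_tm (f (Ann q M)) (g q M)) ->
  forall M, normal tau_step (f M) -> not_ann M.
Proof. intros Hf M H q N ->; apply (H (g q N)), cl_tm_root, Hf. Qed.

Lemma normal_Lam M :
  normal tau_step (Lam M) -> normal tau_step M /\ not_ann M.
Proof.
  intros H; split; revert H.
  - apply (normal_map Lam); intros; constructor; assumption.
  - apply (normal_not_ann Lam _ ta_lam).
Qed.

Lemma normal_Bang q M :
  normal tau_step (Bang q M) -> normal tau_step M /\ not_ann M.
Proof.
  intros H; split; revert H.
  - apply (normal_map (Bang q)); intros; constructor; assumption.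
  - apply (normal_not_ann (Bang q) _ (ta_bang q)).
Qed.

Lemma normal_App M N :
  normal tau_step (App M N) ->
  (normal tau_step M /\ not_ann M) /\ (normal tau_step N /\ not_ann N).
Proof.
  intros H; repeat split; revert H.
  - apply (normal_map (fun M => App M N)); intros; constructor; assumption.
  - apply (normal_not_ann (fun M => App M N) _ (fun q M => ta_app_l q M N)).
  - apply (normal_map (App M)); intros; constructor; assumption.
  - apply (normal_not_ann (App M) _ (fun q => ta_app_r q M)).
Qed.

Lemma normal_Let M N :
  normal tau_step (Let M N) ->
  (normal tau_step M /\ not_ann M) /\ (normal tau_step N /\ not_ann N).
Proof.
  intros H; repeat split; revert H.
  - apply (normal_map (fun M => Let M N)); intros; constructor; assumption.
  - apply (normal_not_ann (fun M => Let M N) _ (fun q M => ta_let_l q M N)).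
  - apply (normal_map (Let M)); intros; constructor; assumption.
  - apply (normal_not_ann (Let M) _ (fun q => ta_let_r q M)).
Qed.

Lemma normal_Iota_not_ann th :
  normal tau_step (Iota th) -> forall b, not_ann (get th b).
Proof.
  intros H b.
  apply (normal_not_ann (fun M => Iota (put th b M)) _ (ta_iota th b)).
  rewrite put_get; exact H.
Qed.

(** Erasure removes only annotations outside bangs and stops at each bang; under these hypotheses it
    meets none and rebuilds the term. *)
Lemma Er_normal M :
  cau_tm M -> normal tau_step M -> not_ann M ->
  clos_refl_trans tm sigmatau_tm (Er M) M.
Proof.
  induction 1 as [n | M _ IHM | M N _ IHM _ IHN | M N _ IHM _ IHN
    | q M _ _ IHM | q M _ _ IHM | th _ IH]; intros Hn Ha.
  - apply rt_step, sigma_step_tm, sg_er_var.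
  - apply normal_Lam in Hn as [].
    eapply rt_trans; [apply rt_step, sigma_step_tm, sg_er_lam |].
    apply (rt_map (R := sigmatau_tm) _ Lam); auto; intros; constructor; assumption.
  - apply normal_App in Hn as [[] []].
    eapply rt_trans; [apply rt_step, sigma_step_tm, sg_er_app |].
    apply (rt_map2 (R := sigmatau_tm) (R' := sigmatau_tm) _ App); auto;
      intros; constructor; assumption.
  - apply normal_Let in Hn as [[] []].
    eapply rt_trans; [apply rt_step, sigma_step_tm, sg_er_let |].
    apply (rt_map2 (R := sigmatau_tm) (R' := sigmatau_tm) _ Let); auto;
      intros; constructor; assumption.
  - apply rt_step, sigma_step_tm, sg_er_bang.
  - destruct (Ha q M eq_refl).
  - eapply rt_trans; [apply rt_step, sigma_step_tm, sg_er_iota |].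
    apply Iota_rt; intros b; rewrite get_fam_map.
    apply IH; [apply normal_Iota | apply normal_Iota_not_ann]; exact Hn.
Qed.

(** With no annotation to collect, extraction builds a trail whose leaves are all [Tr_r], and the
    tau-rules collapse it. The claim is a reduction and not just an equivalence because [Beta_iota]
    asks for a normal form reached by reduction. *)
Lemma Tl_normal M :
  cau_tm M -> normal tau_step M -> not_ann M ->
  clos_refl_trans tr sigmatau_tr (Tl M) Tr_r.
Proof.
  induction 1 as [n | M _ IHM | M N _ IHM _ IHN | M N _ IHM _ IHN
    | q M _ _ IHM | q M _ _ IHM | th _ IH]; intros Hn Ha.
  - apply rt_step, sigma_step_tr, sg_tl_var.
  - apply normal_Lam in Hn as [].
    eapply rt_trans; [apply rt_step, sigma_step_tr, sg_tl_lam |].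
    eapply rt_trans; [| apply rt_step, tau_step_tr, ta_lam_r].
    apply (rt_map (R := sigmatau_tr) _ Tr_lam); auto; intros; constructor; assumption.
  - apply normal_App in Hn as [[] []].
    eapply rt_trans; [apply rt_step, sigma_step_tr, sg_tl_app |].
    eapply rt_trans; [| apply rt_step, tau_step_tr, ta_app_rr].
    apply (rt_map2 (R := sigmatau_tr) (R' := sigmatau_tr) _ Tr_app); auto;
      intros; constructor; assumption.
  - apply normal_Let in Hn as [[] []].
    eapply rt_trans; [apply rt_step, sigma_step_tr, sg_tl_let |].
    eapply rt_trans; [| apply rt_step, tau_step_tr, ta_let_rr].
    apply (rt_map2 (R := sigmatau_tr) (R' := sigmatau_tr) _ Tr_let); auto;
      intros; constructor; assumption.
  - apply rt_step, sigma_step_tr, sg_tl_bang.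
  - destruct (Ha q M eq_refl).
  - eapply rt_trans; [apply rt_step, sigma_step_tr, sg_tl_iota |].
    eapply rt_trans; [| apply rt_step, tau_step_tr, ta_tr_r].
    apply Tr_tr_rt; intros b; rewrite get_fam_map.
    replace (get (fam_const Tr_r) b) with Tr_r by (destruct b; reflexivity).
    apply IH; [apply normal_Iota | apply normal_Iota_not_ann]; exact Hn.
Qed.

(** * Simulation *)

Fixpoint fctx_sigma_of (F : fctx) : fctx_sigma :=
  match F with
  | F_hole => FS_hole
  | F_lam F => FS_lam (fctx_sigma_of F)
  | F_app_l F N => FS_app_l (fctx_sigma_of F) N
  | F_app_r M F => FS_app_r M (fctx_sigma_of F)
  | F_let_l F N => FS_let_l (fctx_sigma_of F) N
  | F_let_r M F => FS_let_r M (fctx_sigma_of F)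
  | F_ann q F => FS_ann q (fctx_sigma_of F)
  | F_iota th b F => FS_iota th b (fctx_sigma_of F)
  end.

Lemma plug_sigma_of F P : plug_sigma (fctx_sigma_of F) P = plug F P.
Proof. induction F; cbn; congruence. Qed.

(** The erasures and extracted trails that [Beta_root] adds are trivial on a tau-normal redex, so
    its contractum agrees with that of [beta_root] up to sigma-tau. *)
Lemma beta_root_sim A B :
  cau_tm A -> normal tau_step A -> beta_root A B ->
  exists C, Beta A C /\ C == B.
Proof.
  intros HA Hn H; destruct H as [M N | q M N | q F th].
  - destruct (cau_tm_inv HA) as [HM%cau_tm_inv HN].
    destruct (normal_App Hn) as [[HnL _] [HnN HaN]].
    destruct (normal_Lam HnL) as [HnM HaM].
    eexists; split; [apply Be_root, Beta_lam |].
    rewrite (clos_rt_clos_rst _ _ _ _ (Tl_normal HM HnM HaM)),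
      (clos_rt_clos_rst _ _ _ _ (Tl_normal HN HnN HaN)),
      (clos_rt_clos_rst _ _ _ _ (Er_normal HM HnM HaM)),
      (clos_rt_clos_rst _ _ _ _ (Er_normal HN HnN HaN)).
    (* With both extracted trails equal to [Tr_r], the trail of the contractum collapses to
       [Tr_ba]. *)
    rewrite (tau_equiv_tr ta_lam_r), (tau_equiv_tr ta_app_rr),
      (tau_equiv_tr (ta_r_t _)), Clo_subst1 by assumption.
    reflexivity.
  - destruct (cau_tm_inv HA) as [[Hq HM]%cau_tm_inv HN].
    destruct (normal_Let Hn) as [_ [HnN HaN]].
    eexists; split; [apply Be_root, Beta_let |].
    rewrite (clos_rt_clos_rst _ _ _ _ (Tl_normal HN HnN HaN)),
      (clos_rt_clos_rst _ _ _ _ (Er_normal HN HnN HaN)).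
    rewrite (tau_equiv_tr ta_let_rr), (tau_equiv_tr (ta_r_t _)),
      Clo_subst1 by (try constructor; assumption).
    reflexivity.
  - destruct (cau_tm_inv HA) as [Hq HM].
    destruct (normal_Bang Hn) as [HnM HaM].
    exists (Bang q (plug F (Ann Tr_ti (inspect th q)))); split; [| reflexivity].
    rewrite <- !plug_sigma_of in *.
    (* The inspected normal form is [q] itself: the extracted trail vanishes, and a sigma-tau step
       from [q] would be a tau-step inside the normal bang. *)
    apply Be_root, Beta_iota; split.
    + apply rt_trans with (Tr_t q Tr_r); [| apply rt_step, tau_step_tr, ta_t_r].
      apply (rt_map (R := sigmatau_tr) _ (Tr_t q));
        [intros; constructor; assumption | apply Tl_normal; assumption].
    + intros q' Hq'; apply (Hn (Bang q' (plug_sigma (fctx_sigma_of F) (Iota th)))).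
      apply cl_Bang_l, sigmatau_tr_cau; assumption.
Qed.

(** This treats one frame [f] of a context: being a CAU^- term and tau-normality descend from [f M]
    to [M], while the Beta step and the equivalence found there are carried back up through [f]. *)
Lemma beta_sim_map (f : tm -> tm) M M' :
  (forall P Q, Beta P Q -> Beta (f P) (f Q)) ->
  (forall P Q, P == Q -> f P == f Q) ->
  (forall P Q, tau_step P Q -> tau_step (f P) (f Q)) ->
  (cau_tm (f M) -> cau_tm M) ->
  (cau_tm M -> normal tau_step M -> exists C, Beta M C /\ C == M') ->
  cau_tm (f M) -> normal tau_step (f M) -> exists C, Beta (f M) C /\ C == f M'.
Proof.
  intros HBeta Hequiv Htau Hcau IH HA Hn.
  destruct (IH (Hcau HA) (normal_map f Htau Hn)) as [C [HC E]].
  exists (f C); auto.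
Qed.

Local Ltac beta_sim_under f :=
  match goal with IH : _ -> _ -> exists _, _ |- _ => revert IH end;
  apply (beta_sim_map f);
  [ constructor; assumption
  | let E := fresh in intros ? ? E; rewrite E; reflexivity
  | intros; constructor; assumption
  | let H := fresh in intros H; apply cau_tm_inv in H; tauto ].

Lemma beta_sim A B :
  beta A B -> cau_tm A -> normal tau_step A -> exists C, Beta A C /\ C == B.
Proof.
  intros H; induction H as [M M' H | M M' _ IH | M M' N _ IH | M N N' _ IH
    | M M' N _ IH | M N N' _ IH | q M M' _ IH | q M M' _ IH | th b M M' _ IH].
  - intros; apply beta_root_sim; assumption.
  - beta_sim_under Lam.
  - beta_sim_under (fun M => App M N).
  - beta_sim_under (App M).
  - beta_sim_under (fun M => Let M N).
  - beta_sim_under (Let M).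
  - beta_sim_under (Bang q).
  - beta_sim_under (Ann q).
  (* Families have no [Proper] instance for rewriting under [put], so this frame uses its own
     congruence and inversion lemmas. *)
  - revert IH; apply (beta_sim_map (fun M => Iota (put th b M))).
    + constructor; assumption.
    + apply Iota_put_equiv.
    + intros; apply cl_Iota; assumption.
    + apply cau_tm_put.
Qed.

(** Tau-normality of [B], built into [cau_step], is returned as well so that the simulation can be
    iterated. *)
Lemma cau_step_sim A B :
  normal tau_step A -> cau_step A B ->
  normal tau_step B /\ clos_refl_trans tm cau_sigma_step A B.
Proof.
  intros Hn [HA [N [HN [HNB HB]]]]; split; [exact HB |].
  destruct (beta_sim HN HA Hn) as [C [HC E]].
  apply rt_trans with C; apply rt_step; [left; exact HC | right].
  rewrite E; apply clos_rt_clos_rst.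
  revert HNB; apply (rt_map _ (fun M => M)); exact tau_step_sigmatau.
Qed.

Lemma cau_steps_sim A B :
  clos_refl_trans tm cau_step A B -> normal tau_step A ->
  clos_refl_trans tm cau_sigma_step A B.
Proof.
  intros H; apply clos_rt_rt1n in H.
  induction H as [A | A A' B HA _ IH]; intros Hn; [apply rt_refl |].
  destruct (cau_step_sim Hn HA) as [Hn' HAA'].
  apply rt_trans with A'; auto.
Qed.

Lemma normal_form_steps N Nst S :
  normal_form_of sigmatau_tm N Nst -> clos_refl_trans tm cau_step Nst S ->
  clos_refl_trans tm cau_sigma_step N S.
Proof.
  intros [HN Hn] HS; apply rt_trans with Nst.
  - apply rt_step; right; apply clos_rt_clos_rst, HN.
  - apply cau_steps_sim; [exact HS |].
    (* A sigma-tau-normal term is tau-normal, which starts the simulation. *)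
    intros M HM; exact (Hn M (tau_step_sigmatau HM)).
Qed.

Theorem theorem4 (M N R Nst Rst : tm)
  (hMN : clos_refl_trans tm cau_sigma_step M N)
  (hMR : clos_refl_trans tm cau_sigma_step M R)
  (hN : normal_form_of sigmatau_tm N Nst)
  (hR : normal_form_of sigmatau_tm R Rst)
  (hjoin : joinable cau_step Nst Rst) :
  joinable cau_sigma_step N R.
Proof.
  destruct hjoin as [S [HN HR]].
  exists S; split; eapply normal_form_steps; eassumption.
Qed.
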